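(* Let $\mathcal M=(\mathcal D,\mathrm x)$ be a time-like surface in $\mathbb R^n_1$ given in isothermal coordinates $(u,v)\in\mathcal D$ (with $E<0$), let $t=u+\mathrm jv$, and let $\Phi(t)=2\frac{\partial\mathrm x}{\partial t}=\mathrm x_u+\mathrm j\,\mathrm x_v$ on $\mathcal D$. Then the following three conditions are equivalent: 1. The function $\Phi(t)$ is holomorphic: $\frac{\partial\Phi}{\partial\bar t}=0$. 2. The function $\mathrm x(u,v)$ is hyperbolically harmonic: $\Delta^h\mathrm x=0$. 3. $\mathcal M=(\mathcal D,\mathrm x)$ is a minimal time-like surface in $\mathbb R^n_1$: $\mathrm H=0$.
   Context: $\mathbb D=\{t=u+\mathrm j v:\ u,v\in\mathbb R\}$ with $\mathrm j^2=1$ is the algebra of double numbers; $\frac{\partial}{\partial t}=\frac12\left(\frac{\partial}{\partial u}+\mathrm j\frac{\partial}{\partial v}\right)$, $\frac{\partial}{\partial\bar t}=\frac12\left(\frac{\partial}{\partial u}-\mathrm j\frac{\partial}{\partial v}\right)$; $\Delta^h=\frac{\partial^2}{\partial u^2}-\frac{\partial^2}{\partial v^2}$. $\mathbb R^n_1$ is $\mathbb R^n$ with $a\cdot b=-a_1b_1+a_2b_2+\dots+a_nb_n$; $\mathbb D^n_1=\mathbb D^n$ with the $\mathbb D$-bilinear extension of this product; $\Phi$ takes values in $\mathbb D^n_1$. A time-like surface $\mathcal M=(\mathcal D,\mathrm x)$ in $\mathbb R^n_1$ is given by a smooth immersion $\mathrm x(u,v):\mathcal D\to\mathbb R^n_1$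 of a domain $\mathcal D\subset\mathbb R^2\cong\mathbb D$ whose induced metric is indefinite. With $E=\mathrm x_u^2$, $F=\mathrm x_u\cdot\mathrm x_v$, $G=\mathrm x_v^2$, the coordinates are isothermal if $E=-G$, $F=0$; the standing convention is $E<0$. The second fundamental form is $\sigma(X,Y)=(\nabla_XY)^\bot$, where $\nabla$ is the canonical flat connection of $\mathbb R^n_1$ and $\bot$ the projection to the normal space; the mean curvature is $\mathrm H=\frac12(-\sigma(X_1,X_1)+\sigma(X_2,X_2))$ for an orthonormal tangent basis with $X_1^2=-1$, $X_2^2=1$. The surface is minimal if $\mathrm H=0$ everywhere. *)

(* Defs.v *)
From HB Require Import structures.
From mathcomp Require Import all_boot all_order all_algebra.
From mathcomp Require Import all_classical all_reals all_analysis.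
From mathcomp Require Import ring.

Set Implicit Arguments.
Unset Strict Implicit.
Unset Printing Implicit Defensive.

Import Order.TTheory GRing.Theory Num.Theory.
Import numFieldNormedType.Exports.

Local Open Scope classical_set_scope.
Local Open Scope ring_scope.

(* Dbl u v is the double number u + j v. *)
Record dbl (R : realType) := Dbl { dre : R; dim : R }.

Section DoubleRing.
Variable R : realType.
Implicit Types s t : dbl R.

Definition pair_of_dbl t : R * R := (dre t, dim t).
Definition dbl_of_pair (p : R * R) : dbl R := Dbl p.1 p.2.

Lemma pair_of_dblK : cancel pair_of_dbl dbl_of_pair.
Proof. by case. Qed.

HB.instance Definition _ := Choice.copy (dbl R) (can_type pair_of_dblK).

Definition dbl_add s t := Dbl (dre s + dre t) (dim s + dim t).
Definition dbl_opp t := Dbl (- dre t) (- dim t).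
Definition dbl_mul s t :=
  Dbl (dre s * dre t + dim s * dim t) (dre s * dim t + dim s * dre t).

Lemma dbl_addA : associative dbl_add.
Proof. by move=> [a b] [c d] [e f]; congr Dbl => /=; ring. Qed.

Lemma dbl_addC : commutative dbl_add.
Proof. by move=> [a b] [c d]; congr Dbl => /=; ring. Qed.

Lemma dbl_add0r : left_id (Dbl 0 0) dbl_add.
Proof. by move=> [a b]; congr Dbl => /=; ring. Qed.

Lemma dbl_addNr : left_inverse (Dbl 0 0) dbl_opp dbl_add.
Proof. by move=> [a b]; congr Dbl => /=; ring. Qed.

HB.instance Definition _ := GRing.isZmodule.Build (dbl R)
  dbl_addA dbl_addC dbl_add0r dbl_addNr.

Lemma dbl_mulA : associative dbl_mul.
Proof. by move=> [a b] [c d] [e f]; congr Dbl => /=; ring. Qed.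

Lemma dbl_mulC : commutative dbl_mul.
Proof. by move=> [a b] [c d]; congr Dbl => /=; ring. Qed.

Lemma dbl_mul1r : left_id (Dbl 1 0) dbl_mul.
Proof. by move=> [a b]; congr Dbl => /=; ring. Qed.

Lemma dbl_mulDl : left_distributive dbl_mul +%R.
Proof. by move=> [a b] [c d] [e f]; congr Dbl => /=; ring. Qed.

Lemma dbl_oner_neq0 : Dbl 1 0 != 0 :> dbl R.
Proof. by apply/eqP => -[] /eqP; rewrite oner_eq0. Qed.

HB.instance Definition _ := GRing.Zmodule_isComNzRing.Build (dbl R)
  dbl_mulA dbl_mulC dbl_mul1r dbl_mulDl dbl_oner_neq0.

Definition dbl_of_real (a : R) : dbl R := Dbl a 0.
Definition dbl_j : dbl R := Dbl 0 1.

Lemma dbl_jj : dbl_j * dbl_j = 1.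
Proof. by congr Dbl => /=; ring. Qed.

Lemma dblE t : t = dbl_of_real (dre t) + dbl_j * dbl_of_real (dim t).
Proof. by case: t => u v; congr Dbl => /=; ring. Qed.

End DoubleRing.
Arguments dbl_j {R}.

(* a . b = - a_1 b_1 + a_2 b_2 + ... + a_n b_n, both on R^n_1 (real entries)
   and on D^n_1 (double entries) *)
Definition mdot (S : comNzRingType) (n : nat) (a b : 'rV[S]_n) : S :=
  \sum_(i < n) (-1) ^+ (i == 0 :> nat) * (a 0 i * b 0 i).

(* The double numbers are identified with R^2 through t = u + j v: functions of t are written as
   functions of the point (u, v) : R * R. *)
Section Calculus.
Variable R : realType.

Definition Du (W : normedModType R) (f : R * R -> W) (p : R * R) : W :=
  'D_((1, 0) : R * R) f p.
Definition Dv (W : normedModType R) (f : R * R -> W) (p : R * R) : W :=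
  'D_((0, 1) : R * R) f p.

(* On an open set D, C^infinity is the same as: f and all its iterated partial
   derivatives are (Frechet) differentiable at every point of D. *)
Fixpoint times_differentiable (k : nat) (W : normedModType R) (D : set (R * R))
    (f : R * R -> W) : Prop :=
  if k is k'.+1 then
    [/\ forall p, D p -> differentiable f p,
        times_differentiable k' D (Du f) & times_differentiable k' D (Dv f)]
  else True.

Definition smooth (W : normedModType R) (D : set (R * R)) (f : R * R -> W) :=
  forall k, times_differentiable k D f.

Definition box_h (W : normedModType R) (f : R * R -> W) (p : R * R) : W :=
  Du (Du f) p - Dv (Dv f) p.

Definition hyp_harmonic (W : normedModType R) (D : set (R * R))
  (f : R * R -> W) := forall p, D p -> box_h f p = 0.

Definition Du_dbl (n : nat) (F : R * R -> 'rV[dbl R]_n) (p : R * R) :=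
  \row_(i < n) Dbl (Du (fun q => dre (F q 0 i)) p)
                   (Du (fun q => dim (F q 0 i)) p).
Definition Dv_dbl (n : nat) (F : R * R -> 'rV[dbl R]_n) (p : R * R) :=
  \row_(i < n) Dbl (Dv (fun q => dre (F q 0 i)) p)
                   (Dv (fun q => dim (F q 0 i)) p).

Definition D_t (n : nat) (F : R * R -> 'rV[dbl R]_n) (p : R * R) :=
  dbl_of_real 2^-1 *: (Du_dbl F p + dbl_j *: Dv_dbl F p).
Definition D_tbar (n : nat) (F : R * R -> 'rV[dbl R]_n) (p : R * R) :=
  dbl_of_real 2^-1 *: (Du_dbl F p - dbl_j *: Dv_dbl F p).

Definition holomorphic (n : nat) (D : set (R * R))
  (F : R * R -> 'rV[dbl R]_n) := forall p, D p -> D_tbar F p = 0.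

End Calculus.

Section Surface.
Variables (R : realType) (n : nat).
Implicit Types (D : set (R * R)) (x : R * R -> 'rV[R]_n) (p : R * R).

Definition row_of_real (a : 'rV[R]_n) : 'rV[dbl R]_n :=
  map_mx (@dbl_of_real R) a.

Definition Phi x p : 'rV[dbl R]_n := 2 *: D_t (row_of_real \o x) p.

Lemma deriv_coord x p (v : R * R) (i : 'I_n) : derivable x p v ->
  'D_v (fun q => x q 0 i) p = 'D_v x p 0 i.
Proof.
move=> dx; apply: cvg_lim; first exact: norm_hausdorff.
pose g (M : 'rV[R]_n) : R := M 0 i.
apply: (@cvg_trans _ (g \o (fun h : R => h^-1 *: ((x \o shift p) (h *: v) - x p))
  @ 0^')).
  by apply: near_eq_cvg; near=> h; rewrite /g /= !mxE.
by apply: continuous_cvg; [exact: coord_continuous|exact: dx].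
Unshelve. all: by end_near. Qed.

Lemma PhiE x p : derivable x p (1, 0) -> derivable x p (0, 1) ->
  Phi x p = row_of_real (Du x p) + dbl_j *: row_of_real (Dv x p).
Proof.
move=> du dv; have h2 : 2 * dbl_of_real 2^-1 = 1 :> dbl R.
  rewrite mulrDl mul1r; congr Dbl => /=; last by rewrite addr0.
  by rewrite [RHS]splitr mul1r.
have dreE i : (fun q => dre ((row_of_real \o x) q 0 i)) = (fun q => x q 0 i).
  by apply/funext => q; rewrite mxE.
have dimE i : (fun q => dim ((row_of_real \o x) q 0 i)) = cst 0.
  by apply/funext => q; rewrite mxE.
have DuE : Du_dbl (row_of_real \o x) p = row_of_real (Du x p).
  apply/rowP => i; rewrite [LHS]mxE [RHS]mxE dreE dimE /Du.
  by rewrite (deriv_coord i du) derive_cst.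
have DvE : Dv_dbl (row_of_real \o x) p = row_of_real (Dv x p).
  apply/rowP => i; rewrite [LHS]mxE [RHS]mxE dreE dimE /Dv.
  by rewrite (deriv_coord i dv) derive_cst.
rewrite /Phi /D_t DuE DvE scalerA.
rewrite h2.
by rewrite scale1r.
Qed.

Definition timelike_surface D x : Prop :=
  [/\ open D, connected D, smooth D x,
      forall p, D p -> injective ('d x p)
    & forall p, D p -> exists a b : R * R,
        mdot ('d x p a) ('d x p a) < 0 < mdot ('d x p b) ('d x p b)].

Definition coefE x p : R := mdot (Du x p) (Du x p).
Definition coefF x p : R := mdot (Du x p) (Dv x p).
Definition coefG x p : R := mdot (Dv x p) (Dv x p).

Definition isothermal D x : Prop := forall p, D p ->
  [/\ coefE x p = - coefG x p, coefF x p = 0 & coefE x p < 0].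

(* m is the component of w normal to the tangent plane range ('d x p); it
   exists and is unique when the induced metric is nondegenerate at p. *)
Definition normal_proj x p (w : 'rV[R]_n) : 'rV[R]_n :=
  xget 0 [set m | (forall a : R * R, mdot m ('d x p a) = 0) /\
                  exists a : R * R, w - m = 'd x p a].

(* A vector field xi on the parameter domain encodes the tangent vector field
   dx(xi) of the surface. *)
Definition tangent_field x (xi : R * R -> R * R) p : 'rV[R]_n := 'd x p (xi p).

(* nabla_X Y for X = dx(xi) and Y a vector field along the surface. *)
Definition flat_connection (xi : R * R -> R * R) (Y : R * R -> 'rV[R]_n) p :=
  'D_(xi p) Y p.

(* sigma (X, Y) at the point p, for X = dx(xi) and Y = dx(eta). *)
Definition second_form x (xi eta : R * R -> R * R) p : 'rV[R]_n :=
  normal_proj x p (flat_connection xi (tangent_field x eta) p).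

Definition orthonormal_at x (xi1 xi2 : R * R -> R * R) p : Prop :=
  let X1 := tangent_field x xi1 p in
  let X2 := tangent_field x xi2 p in
  [/\ mdot X1 X1 = -1, mdot X2 X2 = 1 & mdot X1 X2 = 0].

(* The common value of (- sigma (X1, X1) + sigma (X2, X2)) / 2 over all smooth
   tangent vector fields X1, X2 which are an orthonormal tangent basis at p. *)
Definition mean_curvature D x p : 'rV[R]_n :=
  xget 0 [set h | exists xi1 xi2 : R * R -> R * R,
    [/\ smooth D xi1, smooth D xi2, orthonormal_at x xi1 xi2 p &
        h = 2^-1 *: (- second_form x xi1 xi1 p + second_form x xi2 xi2 p)]].

Definition minimal_timelike_surface D x : Prop :=
  timelike_surface D x /\ forall p, D p -> mean_curvature D x p = 0.

End Surface.

(* Main.v *)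
(* Write x_uu, x_uv, x_vv for the second derivatives of x.  By the symmetry of
   the mixed ones, 2 dPhi/dtbar = (x_uu - x_vv) + j (x_uv - x_vu) = box x, so
   Phi is holomorphic exactly when x is hyperbolically harmonic.  For the mean
   curvature, any orthonormal tangent basis gives H = (2E)^-1 (box x)^bot, the
   terms in which the tangent fields are differentiated being tangential.
   Differentiating E = -G and F = 0 shows that box x is already normal, so
   H = (2E)^-1 box x. *)
From HB Require Import structures.
From mathcomp Require Import all_boot all_order all_algebra.
From mathcomp Require Import all_classical all_reals all_analysis.
From mathcomp Require Import ring lra.
Require Import Defs.

Set Implicit Arguments.
Unset Strict Implicit.
Unset Printing Implicit Defensive.

Import Order.TTheory GRing.Theory Num.Theory.
Import numFieldNormedType.Exports.

Local Open Scope classical_set_scope.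
Local Open Scope ring_scope.

(** * Symmetry of mixed directional derivatives for real-valued functions *)

Section Schwarz.
Variables (R : realType) (V : normedModType R).
Implicit Types (f : V -> R) (a b p q : V).

(** Restriction to a line, which brings directional derivatives within reach of the one-variable
    mean value theorem. *)
Lemma is_derive_line f q a (s df : R) : is_derive (s *: a + q) a f df ->
  is_derive s 1 (fun s : R => f (s *: a + q)) df.
Proof.
have lineE : (fun h : R => h^-1 *: (((fun s : R => f (s *: a + q)) \o shift s) (h *: 1)
    - f (s *: a + q))) =
    (fun h : R => h^-1 *: ((f \o shift (s *: a + q)) (h *: a) - f (s *: a + q))).
  by apply/funext => h /=; rewrite addrA -scalerDl [h *: 1]mulr1.
by move=> [dfa <-]; apply: DeriveDef; rewrite /derivable /derive lineE.
Qed.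

Definition second_diff f a b p (h : R) : R :=
  f (h *: a + (h *: b + p)) - f (h *: b + p) - (f (h *: a + p) - f p).

Lemma second_diffC f a b p h : second_diff f a b p h = second_diff f b a p h.
Proof. by rewrite /second_diff addrCA; lra. Qed.

(* Apply the mean value theorem along a, then the expansion of F at p. *)
Lemma second_diff_cvg f F a b p : (\forall q \near p, is_derive q a f (F q)) ->
  differentiable F p ->
  (fun h : R => h^-2 * second_diff f a b p h) @ 0^'+ --> 'D_b F p.
Proof.
move=> df dF.
rewrite deriveE//; set L := 'd F p.
have LZ k (v : V) : L (k *: v) = k * L v by rewrite linearZ.
have LD (u v : V) : L (u + v) = L u + L v by rewrite linearD.
apply/cvgrPdist_le => /= e e0.
(* All increments used below have norm at most [h * M]; the summand 1 keeps [M] positive when [a]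
   and [b] vanish. With [d = e / (2 * M)] each of the two expansions of [F] costs at most
   [h * (e / 2)]. *)
pose M := `|a| + `|b| + 1.
have a0 := normr_ge0 a; have b0 := normr_ge0 b.
have M0 : 0 < M by rewrite /M; lra.
pose d := e / (2 * M).
have d0 : 0 < d by rewrite divr_gt0// mulr_gt0.
have [r r0 Hr] : exists2 r : R, 0 < r & forall k : V, `|k| < r ->
    is_derive (k + p) a f (F (k + p)) /\ `|F (k + p) - F p - L k| <= d * `|k|.
  have /eqaddoP /(_ d d0) near0 := diff_locally dF.
  have df0 : \forall k \near (0 : V), is_derive (k + p) a f (F (k + p)).
    by move: df; rewrite (near_shift 0) => df; near=> k;
      rewrite -[p]subr0; near: k; exact: df.
  have /nbhs_norm0P[r /= r0 rP] : \forall k \near (0 : V),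
    is_derive (k + p) a f (F (k + p)) /\
    `|(F \o shift p - (cst (F p) + L)) k| <= d * `|k| by apply: filterI.
  exists r => // k kr; have [dk] := rP k kr.
  rewrite /= opprD -![(_ + _ : _ -> _) _]/(_ + _) -![(- _ : _ -> _) _]/(- _).
  by rewrite /= addrA.
near=> h.
have h0 : 0 < h by near: h; exact: nbhs_right_gt.
have hr : h * M < r.
  rewrite -ltr_pdivlMr//; near: h; apply: nbhs_right_lt; exact: divr_gt0.
have small c : 0 <= c <= h -> `|c *: a| <= h * M /\ `|c *: a + h *: b| <= h * M.
  move=> /andP[c0 ch].
  have ca : `|c *: a| <= h * `|a| by rewrite normrZ ger0_norm// ler_wpM2r.
  have hb : `|h *: b| = h * `|b| by rewrite normrZ gtr0_norm.
  have := ler_normD (c *: a) (h *: b); rewrite hb /M => H; split; nra.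
(* The second difference is [g h - g 0], hence [h * dg c] for some [c] in between, and [dg c]
   differs from [h * L b] by at most [h * e]. *)
pose g s : R := f (s *: a + (h *: b + p)) - f (s *: a + p).
pose dg s : R := F (s *: a + (h *: b + p)) - F (s *: a + p).
have gd s : 0 <= s <= h -> is_derive s 1 g (dg s).
  move=> /small[s1 s2]; apply: is_deriveB; apply: is_derive_line.
    by rewrite addrA; apply: (Hr _ _).1; exact: le_lt_trans hr.
  by apply: (Hr _ _).1; exact: le_lt_trans hr.
have [||c] := @MVT R g dg 0 h h0.
- by move=> s; rewrite in_itv /= => /andP[/ltW ? /ltW ?]; apply: gd; apply/andP.
- apply: derivable_within_continuous => s; rewrite in_itv /= => sh.
  by have [] := gd s sh.
rewrite in_itv /= => /andP[/ltW c0 /ltW ch].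
have ->: g h - g 0 = second_diff f a b p h.
  by rewrite /g /second_diff !scale0r !add0r; lra.
rewrite subr0 => ->.
have [s1 s2] : _ /\ _ := small c (introT andP (conj c0 ch)).
have [_ e1] := Hr _ (le_lt_trans s1 hr).
have [_ e2] := Hr _ (le_lt_trans s2 hr).
rewrite LD !LZ in e1 e2.
have dE : d * (h * M) = h * (e / 2).
  by rewrite /d; field; rewrite gt_eqF.
have e1' : `|F (c *: a + p) - F p - c * L a| <= h * (e / 2).
  by rewrite -dE (le_trans e1)// ler_wpM2l// ltW.
have e2' : `|F (c *: a + h *: b + p) - F p - (c * L a + h * L b)| <= h * (e / 2).
  by rewrite -dE (le_trans e2)// ler_wpM2l// ltW.
have -> : L b - h ^- 2 * (dg c * h) = h^-1 * (h * L b - dg c).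
  by field; rewrite gt_eqF.
rewrite normrM gtr0_norm ?invr_gt0// ler_pdivrMl//.
rewrite /dg [_ *: _ + (_ + p)]addrA.
by move: e1' e2'; rewrite !ler_norml => /andP[? ?] /andP[? ?]; apply/andP; split; lra.
Unshelve. all: by end_near. Qed.

(** The second difference is symmetric in [a] and [b], so both sides are limits of one and the same
    quotient. *)
Lemma derive_swap f Fa Fb a b p :
  (\forall q \near p, is_derive q a f (Fa q)) ->
  (\forall q \near p, is_derive q b f (Fb q)) ->
  differentiable Fa p -> differentiable Fb p -> 'D_b Fa p = 'D_a Fb p.
Proof.
move=> fa fb dFa dFb; have ab := second_diff_cvg (b := b) fa dFa.
have ba := second_diff_cvg (b := a) fb dFb.
apply: (cvg_unique _ ab); first exact: norm_hausdorff.
by have -> : second_diff f a b p = second_diff f b a p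
  by apply/funext => h; exact: second_diffC.
Qed.

End Schwarz.

(** * Bilinearity and symmetry of the Minkowski product *)

Section MinkowskiProduct.
Variables (R : realType) (n : nat).
Implicit Types (a b c : 'rV[R]_n) (k : R).

Lemma mdotC a b : mdot a b = mdot b a.
Proof. by apply: eq_bigr => i _; rewrite [a 0 i * _]mulrC. Qed.

Lemma mdotDl a b c : mdot (a + b) c = mdot a c + mdot b c.
Proof. by rewrite /mdot -big_split; apply: eq_bigr => i _; rewrite mxE mulrDl mulrDr. Qed.

Lemma mdotZl k a b : mdot (k *: a) b = k * mdot a b.
Proof. by rewrite /mdot mulr_sumr; apply: eq_bigr => i _; rewrite mxE; ring. Qed.

Lemma mdotNl a b : mdot (- a) b = - mdot a b.
Proof. by rewrite -scaleN1r mdotZl mulN1r. Qed.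

Lemma mdotDr a b c : mdot a (b + c) = mdot a b + mdot a c.
Proof. by rewrite mdotC mdotDl ![mdot _ a]mdotC. Qed.

Lemma mdotZr k a b : mdot a (k *: b) = k * mdot a b.
Proof. by rewrite mdotC mdotZl mdotC. Qed.

Lemma mdotNr a b : mdot a (- b) = - mdot a b.
Proof. by rewrite mdotC mdotNl mdotC. Qed.

Definition mdotE := (mdotDl, mdotDr, mdotZl, mdotZr, mdotNl, mdotNr).

End MinkowskiProduct.

(** * Leibniz rules and symmetry of mixed derivatives for row-valued functions *)

Section RowDerivative.
Variables (R : realType) (n : nat) (V : normedModType R).
Implicit Types (f g : V -> 'rV[R]_n) (p v : V).

Lemma derivable_coord f p v (i : 'I_n) : derivable f p v -> derivable (fun q => f q 0 i) p v.
Proof. by move=> /derivable_mxP. Qed.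
Arguments derivable_coord {f p v} i _.

Lemma differentiable_coord_row f p i : differentiable f p ->
  differentiable (fun q => f q 0 i) p.
Proof.
by move=> df; apply: (@differentiable_comp _ _ _ _ f (fun M : 'rV[R]_n => M 0 i))
  => //; exact: differentiable_coord.
Qed.

Lemma derive_coord f p v i : derivable f p v ->
  'D_v (fun q => f q 0 i) p = 'D_v f p 0 i.
Proof. by move=> df; rewrite derive_mx// mxE. Qed.

Lemma is_derive_mdot f g p v : derivable f p v -> derivable g p v ->
  is_derive p v (fun q => mdot (f q) (g q))
    (mdot ('D_v f p) (g p) + mdot (f p) ('D_v g p)).
Proof.
move=> df dg.
have dfi i := derivable_coord i df; have dgi i := derivable_coord i dg.
pose h (i : 'I_n) : V -> R :=
  (-1) ^+ (i == 0 :> nat) \*: ((fun q => f q 0 i) * (fun q => g q 0 i)).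
have dh i : derivable (h i) p v by exact: derivableZ (derivableM (dfi i) (dgi i)).
have -> : (fun q => mdot (f q) (g q)) = \sum_(i < n) h i.
  by apply/funext => q; rewrite fct_sumE.
apply: DeriveDef; first exact: derivable_sum dh.
rewrite (derive_sum dh) /mdot -big_split; apply: eq_bigr => i _ /=.
rewrite /h (deriveZ _ (derivableM (dfi i) (dgi i))) (deriveM (dfi i) (dgi i)).
rewrite (derive_coord i df) (derive_coord i dg) /GRing.scale /=; ring.
Qed.

Lemma derive_scale (k : V -> R) f p v : derivable k p v -> derivable f p v ->
  derivable (fun q => k q *: f q) p v /\
  'D_v (fun q => k q *: f q) p = 'D_v k p *: f p + k p *: 'D_v f p.
Proof.
move=> dk df.
have coordE i : (fun q => (k q *: f q) 0 i) = k * (fun q => f q 0 i).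
  by apply/funext => q; rewrite mxE.
have dkf : derivable (fun q => k q *: f q) p v.
  apply/derivable_mxP => i j; rewrite (ord1 i) coordE.
  exact: derivableM dk (derivable_coord j df).
split=> //; apply/rowP => i; rewrite -(derive_coord i dkf) coordE.
rewrite (deriveM dk (derivable_coord i df)) (derive_coord i df) !mxE.
by rewrite addrC /GRing.scale /= [f p 0 i * _]mulrC.
Qed.

Lemma derive_row_swap f a b p : (\forall q \near p, differentiable f q) ->
  differentiable ('D_a f) p -> differentiable ('D_b f) p ->
  'D_b ('D_a f) p = 'D_a ('D_b f) p.
Proof.
move=> df da db; apply/rowP => i.
have coordE v : \forall q \near p,
    is_derive q v (fun q => f q 0 i) ('D_v f q 0 i).
  near=> q; have dfq : derivable f q v by apply: diff_derivable; near: q.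
  by apply: DeriveDef; [exact: (derivable_coord i dfq)|exact: (derive_coord i dfq)].
have dab : derivable ('D_a f) p b by exact: diff_derivable.
have dba : derivable ('D_b f) p a by exact: diff_derivable.
apply: etrans (esym (derive_coord i dab)) (etrans _ (derive_coord i dba)).
exact: (derive_swap (coordE a) (coordE b) (differentiable_coord_row i da)
  (differentiable_coord_row i db)).
Unshelve. all: by end_near. Qed.

End RowDerivative.

(** * Partial derivatives and the algebra of Lorentzian bases *)

Section SmoothSurface.
Variables (R : realType) (n : nat).
Implicit Types (D : set (R * R)) (x : R * R -> 'rV[R]_n) (p a : R * R).

Lemma smooth_cst (W : normedModType R) D (c : W) : smooth D (fun _ => c).
Proof.
move=> k; elim: k c => //= k IH c.
have dcst v : (fun p => 'D_v (fun _ : R * R => c) p) = (fun _ => 0).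
  by apply/funext => p; rewrite derive_cst.
by split; [move=> p _; exact: differentiable_cst | rewrite /Du dcst | rewrite /Dv dcst].
Qed.

Lemma diff_partials (W : normedModType R) (f : R * R -> W) p a :
  differentiable f p -> 'd f p a = a.1 *: Du f p + a.2 *: Dv f p.
Proof.
move=> df; rewrite /Du /Dv !deriveE// -!linearZ -linearD; congr ('d f p _).
by case: a => a1 a2; congr pair; rewrite /= /GRing.scale /= !mulr0 !mulr1 ?addr0 ?add0r.
Qed.

Lemma derive_partials (W : normedModType R) (f : R * R -> W) p a :
  differentiable f p -> 'D_a f p = a.1 *: Du f p + a.2 *: Dv f p.
Proof. by move=> df; rewrite deriveE// diff_partials. Qed.

(* The hypotheses say that (a, b), (c, d) is an orthonormal basis for the form
   diag(1, -1) / k; they force (c, d) = (b, a) or (c, d) = - (b, a). *)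
Lemma lorentz_basis (k a b c d : R) : k < 0 ->
  a ^+ 2 - b ^+ 2 = - k -> c ^+ 2 - d ^+ 2 = k -> a * c = b * d ->
  [/\ c ^+ 2 - a ^+ 2 = k, c * d = a * b & d ^+ 2 - b ^+ 2 = - k].
Proof.
move=> k0 ab cd acbd.
(* Eliminating [c ^+ 2] and [b ^+ 2] from the square of [a * c = b * d] leaves
   [k * a ^+ 2 = k * d ^+ 2]. *)
have ad : a ^+ 2 = d ^+ 2.
  apply: (mulfI (lt0r_neq0 (_ : 0 < - k))); first lra.
  have : a ^+ 2 * c ^+ 2 = b ^+ 2 * d ^+ 2 by rewrite -!exprMn acbd.
  have -> : c ^+ 2 = k + d ^+ 2 by lra.
  have -> : b ^+ 2 = a ^+ 2 + k by lra.
  by move=> H; lra.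
have a0 : a != 0.
  by apply/eqP => a0; have := sqr_ge0 b; move: ab; rewrite a0 expr0n /=; lra.
split; [by lra| |by lra].
by apply: (mulfI a0); rewrite mulrA acbd -mulrA -expr2 -ad; ring.
Qed.

(** By [lorentz_basis] the coefficients of [xuu] and [xvv] are [k] and [- k], while both mixed terms
    carry [c * d - a * b = 0]. *)
Lemma lorentz_trace (k a b c d : R) (xuu xuv xvu xvv : 'rV[R]_n) : k < 0 ->
  a ^+ 2 - b ^+ 2 = - k -> c ^+ 2 - d ^+ 2 = k -> a * c = b * d ->
  - (a *: (a *: xuu + b *: xuv) + b *: (a *: xvu + b *: xvv)) +
    (c *: (c *: xuu + d *: xuv) + d *: (c *: xvu + d *: xvv)) = k *: (xuu - xvv).
Proof.
move=> k0 ab cd acbd; have [ca cdab db] := lorentz_basis k0 ab cd acbd.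
apply/rowP => i; rewrite !mxE mulrBr -{1}ca -[k]opprK -db.
have := congr1 (fun z => z * (xuv 0 i + xvu 0 i)) cdab => /= {}cdab.
by lra.
Qed.

(** * Normal projection and second fundamental form at a point with an isothermal frame *)

Section Isothermal.
Variables (x : R * R -> 'rV[R]_n) (p : R * R) (Xu Xv : 'rV[R]_n) (E : R).
Hypotheses (dxE : forall a, 'd x p a = a.1 *: Xu + a.2 *: Xv)
  (uu : mdot Xu Xu = E) (vv : mdot Xv Xv = - E) (uv : mdot Xu Xv = 0) (E0 : E < 0).

Let vu : mdot Xv Xu = 0. Proof. by rewrite mdotC. Qed.
Let EN0 : E != 0. Proof. by rewrite lt_eqF. Qed.

(** Orthogonal expansion in the frame; the plus sign comes from [mdot Xv Xv = - E]. Since [E] is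
    nonzero, exactly one row qualifies, so [xget] does not fall back on its default. *)
Lemma normal_projE w : normal_proj x p w =
  w - (mdot w Xu / E) *: Xu + (mdot w Xv / E) *: Xv.
Proof.
rewrite /normal_proj; set P := [set m | _].
set m0 := _ + _.
have Pm0 : P m0.
  split=> [a|]; last first.
    exists (mdot w Xu / E, - (mdot w Xv / E)).
    by rewrite dxE /= /m0; apply/rowP => i; rewrite !mxE; ring.
  rewrite dxE /m0 !mdotE uu vv uv vu.
  by field.
(* Uniqueness: pairing [w = m + 'd x p a] with [Xu] and [Xv] determines [a], hence [m]. *)
apply: xget_unique Pm0 _ => m [mT [a]]; rewrite dxE => wm.
have mu : mdot m Xu = 0.
  by have := mT (1, 0); rewrite dxE /= scale1r scale0r addr0.
have mv : mdot m Xv = 0.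
  by have := mT (0, 1); rewrite dxE /= scale1r scale0r add0r.
have wE : w = m + (a.1 *: Xu + a.2 *: Xv) by rewrite -wm addrCA subrr addr0.
have wu : mdot w Xu = a.1 * E by rewrite wE !mdotE uu vu mu; ring.
have wv : mdot w Xv = - (a.2 * E) by rewrite wE !mdotE vv uv mv; ring.
rewrite /m0 wu wv wE; apply/rowP => i; rewrite !mxE; field; exact: EN0.
Qed.

Lemma normal_projD w1 w2 :
  normal_proj x p (w1 + w2) = normal_proj x p w1 + normal_proj x p w2.
Proof.
rewrite !normal_projE !mdotE; apply/rowP => i; rewrite !mxE; field; exact: EN0.
Qed.

Lemma normal_projZ k w : normal_proj x p (k *: w) = k *: normal_proj x p w.
Proof.
rewrite !normal_projE !mdotE; apply/rowP => i; rewrite !mxE; field; exact: EN0.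
Qed.

Lemma normal_proj_tangent c d : normal_proj x p (c *: Xu + d *: Xv) = 0.
Proof.
rewrite !normal_projE !mdotE uu vv uv vu; apply/rowP => i; rewrite !mxE.
field; exact: EN0.
Qed.

Lemma normal_proj_id w : mdot w Xu = 0 -> mdot w Xv = 0 -> normal_proj x p w = w.
Proof. by move=> wu wv; rewrite normal_projE wu wv !mul0r !scale0r subr0 addr0. Qed.

(** Provides a concrete orthonormal basis, obtained by rescaling the isothermal frame; [Xu] is the
    time-like direction because [E < 0]. *)
Lemma orthonormal_scaled s : s * s = - E^-1 ->
  orthonormal_at x (fun _ => (s, 0)) (fun _ => (0, s)) p.
Proof.
move=> ss; rewrite /orthonormal_at /tangent_field !dxE /= !scale0r addr0 add0r.
rewrite !mdotE uu vv uv !mulr0; split=> //.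
  by rewrite mulrA ss mulNr mulVf.
by rewrite mulrA ss mulrNN mulVf.
Qed.

Hypotheses (dx_near : \forall q \near p, differentiable x q)
  (dxu : differentiable (Du x) p) (dxv : differentiable (Dv x) p)
  (XuE : Du x p = Xu) (XvE : Dv x p = Xv).

(** In the Leibniz expansion of the tangent field, the terms that differentiate [eta] are
    combinations of [Xu] and [Xv], which the projection kills. *)
Lemma second_formE (xi eta : R * R -> R * R) : differentiable eta p ->
  second_form x xi eta p = normal_proj x p
    ((eta p).1 *: ((xi p).1 *: Du (Du x) p + (xi p).2 *: Dv (Du x) p) +
     (eta p).2 *: ((xi p).1 *: Du (Dv x) p + (xi p).2 *: Dv (Dv x) p)).
Proof.
move=> deta; rewrite /second_form /flat_connection.
(* The expansion in partials is available where [x] is differentiable; a neighbourhood of [p]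
   suffices for the derivative at [p]. *)
have tangentE : \forall q \near p, tangent_field x eta q =
    ((fun q => (eta q).1 *: Du x q) + (fun q => (eta q).2 *: Dv x q)) q.
  by near=> q; rewrite /tangent_field diff_partials//; near: q.
have d1 : derivable (fun q => (eta q).1) p (xi p).
  apply/diff_derivable/(@differentiable_comp _ _ _ _ eta fst) => //.
  apply: linear_differentiable => q; exact: cvg_fst.
have d2 : derivable (fun q => (eta q).2) p (xi p).
  apply/diff_derivable/(@differentiable_comp _ _ _ _ eta snd) => //.
  apply: linear_differentiable => q; exact: cvg_snd.
have [dU dUE] := derive_scale d1 (@diff_derivable _ _ _ _ _ (xi p) dxu).
have [dV dVE] := derive_scale d2 (@diff_derivable _ _ _ _ _ (xi p) dxv).
have YE := etrans (near_eq_derive (xi p) tangentE)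
  (etrans (deriveD dU dV) (congr2 +%R dUE dVE)).
rewrite YE XuE XvE.
rewrite [X in (eta p).1 *: X](derive_partials (xi p) dxu).
rewrite [X in (eta p).2 *: X](derive_partials (xi p) dxv) addrACA.
by rewrite normal_projD normal_proj_tangent add0r.
Unshelve. all: by end_near. Qed.

Lemma orthonormal_second_formE (xi1 xi2 : R * R -> R * R) :
  differentiable xi1 p -> differentiable xi2 p -> orthonormal_at x xi1 xi2 p ->
  - second_form x xi1 xi1 p + second_form x xi2 xi2 p =
  E^-1 *: normal_proj x p (box_h x p).
Proof.
move=> dxi1 dxi2 []; rewrite /tangent_field !dxE.
rewrite !second_formE//; case: (xi1 p) (xi2 p) => [a b] [c d] /=.
rewrite !mdotE uu vv uv vu => h1 h2 h3.
have kE : E * E^-1 = 1 by rewrite mulfV.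
rewrite -scaleN1r -!normal_projZ -normal_projD scaleN1r; congr normal_proj.
(* Here [k = E^-1]: in the frame, orthonormality reads [E (a^2 - b^2) = -1], [E (c^2 - d^2) = 1] and
   [E (a c - b d) = 0]. *)
apply: lorentz_trace.
- by rewrite invr_lt0.
- by apply: (mulfI EN0); rewrite mulrN kE; lra.
- by apply: (mulfI EN0); rewrite kE; lra.
- by apply: (mulfI EN0); lra.
Qed.

End Isothermal.
End SmoothSurface.

(** * Rows of double numbers assembled from real rows *)

Section DoubleRows.
Variables (R : realType) (n : nat).
Implicit Types (a b c : 'rV[R]_n) (i : 'I_n).

Lemma dre_row a b i : dre ((row_of_real a + dbl_j *: row_of_real b) 0 i) = a 0 i.
Proof. by rewrite !mxE /=; ring. Qed.

Lemma dim_row a b i : dim ((row_of_real a + dbl_j *: row_of_real b) 0 i) = b 0 i.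
Proof. by rewrite !mxE /=; ring. Qed.

(** Used with the second partials [x_uu], [x_uv], [x_vv] as [a], [b], [c]: the terms [j b] cancel,
    and [j^2 = 1] makes [j (j c)] real. *)
Lemma tbar_row a b c : (\row_i Dbl (a 0 i) (b 0 i) : 'rV[dbl R]_n) -
  dbl_j *: (\row_i Dbl (b 0 i) (c 0 i)) = row_of_real (a - c).
Proof. by apply/rowP => i; rewrite !mxE; congr Dbl => /=; ring. Qed.

End DoubleRows.

(** * Holomorphy, the wave operator and the mean curvature on the whole domain *)

Section IsothermalSurface.
Variables (R : realType) (n : nat) (D : set (R * R)) (x : R * R -> 'rV[R]_n).
Hypotheses (oD : open D) (sx : smooth D x).
Implicit Types p : R * R.

Lemma smooth_differentiable p : D p ->
  [/\ differentiable x p, differentiable (Du x) p & differentiable (Dv x) p].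
Proof. by move: (sx 2) => [dx [du _ _] [dv _ _]] Dp; split; [exact: dx|exact: du|exact: dv]. Qed.

Lemma near_domain p : D p -> \forall q \near p, D q.
Proof. by move=> Dp; apply: open_nbhs_nbhs. Qed.

Lemma near_differentiable p : D p -> \forall q \near p, differentiable x q.
Proof.
by move=> /near_domain; apply: filterS => q /smooth_differentiable[].
Qed.

Lemma mixed_partials p : D p -> Dv (Du x) p = Du (Dv x) p.
Proof.
move=> Dp; have [_ du dv] := smooth_differentiable Dp.
exact: (derive_row_swap (near_differentiable Dp) du dv).
Qed.

Lemma D_tbar_PhiE p : D p ->
  D_tbar (Phi x) p = dbl_of_real 2^-1 *: row_of_real (box_h x p).
Proof.
move=> Dp; have [_ du dv] := smooth_differentiable Dp.
have PhiD : \forall q \near p,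
    Phi x q = row_of_real (Du x q) + dbl_j *: row_of_real (Dv x q).
  apply: filterS (near_differentiable Dp) => q dq.
  by apply: PhiE; exact: diff_derivable.
have reE i : \forall q \near p, dre (Phi x q 0 i) = Du x q 0 i.
  by apply: filterS PhiD => q ->; exact: dre_row.
have imE i : \forall q \near p, dim (Phi x q 0 i) = Dv x q 0 i.
  by apply: filterS PhiD => q ->; exact: dim_row.
have duE v i := etrans (near_eq_derive v (reE i))
  (derive_coord i (@diff_derivable _ _ _ _ _ v du)).
have dvE v i := etrans (near_eq_derive v (imE i))
  (derive_coord i (@diff_derivable _ _ _ _ _ v dv)).
have DuE : Du_dbl (Phi x) p = \row_i Dbl (Du (Du x) p 0 i) (Du (Dv x) p 0 i).
  by apply/rowP => i; rewrite [LHS]mxE [RHS]mxE; congr Dbl; [exact: duE|exact: dvE].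
(* Symmetry of the mixed partials gives both rows a common entry, as [tbar_row] requires. *)
have dvu : 'D_(0, 1) (Du x) p = Du (Dv x) p := mixed_partials Dp.
have DvE : Dv_dbl (Phi x) p = \row_i Dbl (Du (Dv x) p 0 i) (Dv (Dv x) p 0 i).
  apply/rowP => i; rewrite [LHS]mxE [RHS]mxE; congr Dbl; last exact: dvE.
  by apply: etrans (duE (0, 1) i) _; rewrite dvu.
rewrite /D_tbar DuE DvE; congr (_ *: _); exact: tbar_row.
Qed.

Lemma holomorphic_Phi_harmonic : holomorphic D (Phi x) <-> hyp_harmonic D x.
Proof.
split=> H p Dp; have := H p Dp; rewrite D_tbar_PhiE//; last first.
  by move=> ->; apply/rowP => i; rewrite !mxE; congr Dbl => /=; ring.
(* The real part of each entry is half the corresponding entry of [box_h x p]. *)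
move=> /rowP box0; apply/rowP => i; have := congr1 (@dre R) (box0 i).
rewrite !mxE /= mul0r addr0 => /eqP.
by rewrite mulf_eq0 invr_eq0 pnatr_eq0 /= => /eqP.
Qed.

Hypothesis isox : isothermal D x.

(** Half the [u]-derivative of [E + G = 0] minus the [v]-derivative of [F = 0] gives the first
    equation; the [u]-derivative of [F] minus half the [v]-derivative of [E + G] gives the
    second. *)
Lemma box_normal p : D p -> mdot (box_h x p) (Du x p) = 0 /\ mdot (box_h x p) (Dv x p) = 0.
Proof.
move=> Dp; have [_ du dv] := smooth_differentiable Dp.
have duP v := @diff_derivable _ _ _ _ _ v du.
have dvP v := @diff_derivable _ _ _ _ _ v dv.
have EG : \forall q \near p, coefE x q + coefG x q = 0.
  by apply: filterS (near_domain Dp) => q /isox[-> _ _]; rewrite addNr.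
have F0 : \forall q \near p, coefF x q = 0.
  by apply: filterS (near_domain Dp) => q /isox[].
have dEG v := is_deriveD (is_derive_mdot (duP v) (duP v)) (is_derive_mdot (dvP v) (dvP v)).
have dF v := is_derive_mdot (duP v) (dvP v).
have EG' v := etrans (esym (@derive_val _ _ _ _ _ _ _ (dEG v)))
  (etrans (near_eq_derive v EG) (derive_cst 0 p v)).
have F' v := etrans (esym (@derive_val _ _ _ _ _ _ _ (dF v)))
  (etrans (near_eq_derive v F0) (derive_cst 0 p v)).
have alg xu xv xuu xuv xvu xvv : xuv = xvu :> 'rV[R]_n ->
    mdot xuu xu + mdot xu xuu + (mdot xvu xv + mdot xv xvu) = 0 ->
    mdot xuv xu + mdot xu xuv + (mdot xvv xv + mdot xv xvv) = 0 ->
    mdot xuu xv + mdot xu xvu = 0 -> mdot xuv xv + mdot xu xvv = 0 ->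
    mdot (xuu - xvv) xu = 0 /\ mdot (xuu - xvv) xv = 0.
  move=> ->; rewrite !mdotE ![mdot xu _]mdotC ![mdot xv _]mdotC => *; split; lra.
exact: alg (mixed_partials Dp) (EG' (1, 0)) (EG' (0, 1)) (F' (1, 0)) (F' (0, 1)).
Qed.

(** The set in [mean_curvature] is a singleton: [trE] makes all its elements equal and a constant
    pair of fields shows it inhabited. A vanishing mean curvature is thus never just the default 0
    of [xget]. *)
Lemma mean_curvatureE p : D p ->
  mean_curvature D x p = (2 * coefE x p)^-1 *: box_h x p.
Proof.
move=> Dp; have [EG F0 E0] := isox Dp.
have [dx du dv] := smooth_differentiable Dp.
have [bu bv] := box_normal Dp.
have dxE a := diff_partials a dx.
have uu := erefl (coefE x p).
have vv : coefG x p = - coefE x p := canRL opprK (esym EG).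
have boxN : normal_proj x p (box_h x p) = box_h x p.
  exact: (@normal_proj_id _ _ x p (Du x p) (Dv x p) (coefE x p) dxE uu vv F0 E0 _ bu bv).
have trE xi1 xi2 (s1 : smooth D xi1) (s2 : smooth D xi2)
    (o12 : orthonormal_at x xi1 xi2 p) :
    2^-1 *: (- second_form x xi1 xi1 p + second_form x xi2 xi2 p) =
    (2 * coefE x p)^-1 *: box_h x p.
  have [d1 _ _] := s1 1%N; have [d2 _ _] := s2 1%N.
  rewrite invfM -scalerA; congr (_ *: _); rewrite -[in RHS]boxN.
  exact: orthonormal_second_formE dxE uu vv F0 E0 (near_differentiable Dp)
    du dv erefl erefl xi1 xi2 (d1 p Dp) (d2 p Dp) o12.
rewrite /mean_curvature; apply: xget_unique; last first.
  by move=> _ [xi1 [xi2 [s1 s2 o12 ->]]]; exact: trE.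
(* The radicand is nonnegative because [E < 0]; constant fields suffice, as orthonormality is
   required only at [p]. *)
pose s : R := Num.sqrt (- (coefE x p)^-1).
pose xi1 : R * R -> R * R := fun _ => (s, 0).
pose xi2 : R * R -> R * R := fun _ => (0, s).
have s1 : smooth D xi1 by exact: smooth_cst.
have s2 : smooth D xi2 by exact: smooth_cst.
have ss : s * s = - (coefE x p)^-1.
  by rewrite -expr2 sqr_sqrtr// oppr_ge0 invr_le0 ltW.
have o12 : orthonormal_at x xi1 xi2 p.
  exact: (@orthonormal_scaled _ _ x p (Du x p) (Dv x p) (coefE x p) dxE uu vv F0 E0 s ss).
by exists xi1, xi2; split=> //; rewrite trE.
Qed.

End IsothermalSurface.

Theorem theorem4p1 (R : realType) (n : nat) (D : set (R * R))
    (x : R * R -> 'rV[R]_n)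
    (hM : timelike_surface D x) (hiso : isothermal D x) :
  (holomorphic D (Phi x) <-> hyp_harmonic D x) /\
  (hyp_harmonic D x <-> minimal_timelike_surface D x).
Proof.
have [oD _ sx _ _] := hM; split; first exact: holomorphic_Phi_harmonic.
split=> [H|[_ H] p Dp].
  by split=> // p Dp; rewrite mean_curvatureE// H// scaler0.
(* The factor [(2 * coefE x p)^-1] is nonzero since [E < 0], so it can be cancelled. *)
have [_ _ E0] := hiso p Dp; have := H p Dp.
rewrite mean_curvatureE// => /eqP; rewrite scaler_eq0 invr_eq0 mulf_eq0.
by rewrite pnatr_eq0 (lt_eqF E0) => /eqP.
Qed.
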